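(* In the setting described in the context (homogeneous ensembles), fix the subsample ratio $c\in(0,1)$ and let $$\mathcal R_M=\frac1M\alpha^2+\Big(1-\frac1M\Big)\eta_G\alpha^2$$ be the limiting risk of the homogeneous ensemble of size $M$. Then $\mathcal R_M$ is strictly decreasing in $M$, i.e. $\mathcal R_{M+1}<\mathcal R_M$ for all integers $M\ge1$.
   Context: $F_\theta,F_z$ are probability distributions on $\mathbb R$, $\delta\in(0,\infty)$, $c\in(0,1)$ is the limit of $k/n$. $\ell:\mathbb R\to\mathbb R$ is proper, closed, convex, differentiable with Lipschitz derivative $\ell'$, $\min_x\ell(x)=\ell(0)$; $\phi:\mathbb R\to\mathbb R\cup\{+\infty\}$ is proper, closed, convex with $\min_x\phi(x)=\phi(0)$. For a proper closed convex $f$ and $\tau>0$: $\mathrm{prox}_f(x;\tau)=\arg\min_{y}\{f(y)+\frac1{2\tau}(x-y)^2\}$, $\mathrm{env}_f(x;\tau)=\min_{y}\{f(y)+\frac1{2\tau}(x-y)^2\}$, $\mathrm{env}_f'(x;\tau)=\frac{\partial}{\partial x}\mathrm{env}_f(x;\tau)=\frac1\tau(x-\mathrm{prox}_f(x;\tau))$. System A, in $(\alpha,\beta,\kappa,\nu)\in\mathbb R_{>0}^4$: $$\alpha^2=\mathbb E\Big[\big(\tfrac1\nu\mathrm{env}_\phi'(\Theta+\tfrac\beta\nu H;\tfrac1\nu)-\tfrac\beta\nu H\big)^2\Big],\qquad \beta^2=c\delta\,\mathbb E\big[\mathrm{env}_\ell'(Z+\alpha G;\kappa)^2\big],$$ $$\kappa\beta=\mathbb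 E\Big[\big(\tfrac1\nu\mathrm{env}_\phi'(\Theta+\tfrac\beta\nu H;\tfrac1\nu)-\tfrac\beta\nu H\big)(-H)\Big],\qquad \nu\alpha=c\delta\,\mathbb E\big[\mathrm{env}_\ell'(Z+\alpha G;\kappa)\,G\big],$$ where $H,G\sim N(0,1)$, $\Theta\sim F_\theta$, $Z\sim F_z$ are mutually independent. Regularity conditions: (1) for all $a\in\mathbb R$, $\mathbb E[\ell_+'(aG+Z)^2]<\infty$ and $\mathbb E[\phi_+'(aH+\Theta)^2]<\infty$, where $f_+'(x)=\sup_{s\in\partial f(x)}|s|$; (2) $\mathbb P(\Theta\ne0)>0$; (3) System A admits a unique positive solution $(\alpha,\beta,\kappa,\nu)\in\mathbb R_{>0}^4$; (4) there exists an interval on which $\ell'$ is strictly increasing, and the support of $F_z$ is $\mathbb R$. System B (homogeneous case), in $(\eta_G,\eta_H)\in[-1,1]^2$: $$\eta_G=\frac1{\alpha^2}\,\mathbb E\Big[\big(\tfrac1\nu\mathrm{env}_\phi'(\Theta+\tfrac\beta\nu H;\tfrac1\nu)-\tfrac\beta\nu H\big)\big(\tfrac1{\nu}\mathrm{env}_{\phi}'(\Theta+\tfrac{\beta}{\nu}\tilde H;\tfrac1{\nu})-\tfrac{\beta}{\nu}\tilde H\big)\Big],$$ $$\eta_H=\frac{c^2\delta}{\beta^2}\,\mathbb E\big[\mathrm{env}_\ell'(Z+\alpha G;\kappa)\,\mathrm{env}_{\ell}'(Z+\alpha\tilde G;\kappa)\big],$$ with $(G,\tilde G)$ and $(H,\tilde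 H)$ centered bivariate Gaussian with unit variances and correlations $\eta_G$ and $\eta_H$ respectively, $\Theta\sim F_\theta$, $Z\sim F_z$, and $(G,\tilde G),(H,\tilde H),\Theta,Z$ mutually independent. System B has a unique solution $(\eta_G,\eta_H)$; its component $\eta_G$ is the one used in $\mathcal R_M$. ($\mathcal R_M$ is the probability limit of $\frac1p\|\tilde\theta_M-\theta\|_2^2$ for the average $\tilde\theta_M$ of $M$ regularized M-estimators with loss $\ell$ and regularizer $\phi$ fit on independent random subsamples of size $k$, as $n/p\to\delta$, $k/n\to c$.) *)

(* Defs.v *)
(* MathComp-Analysis development, over an abstract [R : realType]. *)
From HB Require Import structures.
From mathcomp Require Import all_boot all_order all_algebra.
From mathcomp Require Import all_classical all_reals all_analysis.

Set Implicit Arguments.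
Unset Strict Implicit.
Unset Printing Implicit Defensive.

Import Order.TTheory GRing.Theory Num.Theory.
Import numFieldNormedType.Exports.

Local Open Scope classical_set_scope.
Local Open Scope ring_scope.

Section convex_analysis.
Context {R : realType}.
Implicit Types (f : R -> \bar R) (x tau : R).

Definition proper_fun f : Prop :=
  (forall x, (-oo < f x)%E) /\ exists x, (f x < +oo)%E.

(* For a proper [f] the right-hand side never has the form [+oo - oo]. *)
Definition convex_efun f : Prop :=
  forall x y t : R, 0 < t < 1 ->
  (f (t * x + (1 - t) * y)%R <= t%:E * f x + (1 - t)%:E * f y)%E.

(* "Closed" means that the epigraph is closed, i.e. lower semicontinuity. *)
Definition proper_closed_convex f : Prop :=
  [/\ proper_fun f, lower_semicontinuous f & convex_efun f].

Definition subdiff f x : set R :=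
  [set s | forall y, (f x + (s * (y - x))%:E <= f y)%E].

(* sup of |s| over the subgradients s at x, taken in [0, +oo]: it is 0 (and not
   -oo) where the subdifferential is empty, as happens outside the domain. *)
Definition max_subgrad f x : \bar R :=
  maxe 0%E (ereal_sup [set `|s|%:E | s in subdiff f x]).

(* The Moreau envelope; the infimum is an attained, finite minimum when [f] is
   proper, closed and convex and [tau > 0], so that [fine] loses nothing. *)
Definition env f tau x : R :=
  fine (ereal_inf
    [set (f y + ((2 * tau)^-1 * (x - y) ^+ 2)%:E)%E | y in [set: R]]).

Definition denv f tau x : R := derive1 (env f tau) x.

End convex_analysis.

Section laws.
Context {R : realType}.
Local Notation RB := (measurableTypeR R).

Definition msupport (mu : probability RB R) : set R :=
  [set x | forall U : set R, open U -> U x -> (0 < mu U)%E].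

Definition gauss : probability RB R := normal_prob (0 : R) 1.

(* Linear map with matrix L = [1, 0; rho, sqrt (1 - rho^2)], the Cholesky factor
   of the correlation matrix: L L^T = [1, rho; rho, 1] when -1 <= rho <= 1. *)
Definition corr_map (rho : R) (w : RB * RB) : RB * RB :=
  (w.1, rho * w.1 + Num.sqrt (1 - rho ^+ 2) * w.2).

Lemma measurable_corr_map rho : measurable_fun [set: RB * RB] (corr_map rho).
Proof.
apply: measurable_fun_pair => /=; first exact: measurable_fst.
by apply: measurable_realfun.measurable_funD; apply: measurable_realfun.measurable_funM.
Qed.

HB.instance Definition _ rho :=
  isMeasurableFun.Build _ _ _ _ (corr_map rho) (measurable_corr_map rho).

(* Centered bivariate Gaussian law with unit variances and correlation [rho],
   the image under L of two independent standard Gaussians; it makes sense in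
   the degenerate cases [rho = 1] and [rho = -1], where there is no density. *)
Definition gauss2 (rho : R) : probability (RB * RB)%type R :=
  distribution (gauss \x gauss)%E (corr_map rho).

End laws.

Section systems.
Context {R : realType}.
Local Notation RB := (measurableTypeR R).
Variables (l : R -> R) (phi : R -> \bar R).
Variables (Ftheta Fz : probability RB R) (c delta : R).

(* (1/nu) env_phi'(theta + (beta/nu) h; 1/nu) - (beta/nu) h *)
Definition reg_term (beta nu theta h : R) : R :=
  nu^-1 * denv phi nu^-1 (theta + beta / nu * h) - beta / nu * h.

(* env_l'(z + alpha g; kappa) *)
Definition loss_term (alpha kappa z g : R) : R :=
  denv (EFin \o l) kappa (z + alpha * g).

(* Expectations are taken under the joint law of the independent variables that
   occur: [w = (Theta, H)] under [Ftheta \x gauss] and [w = (Z, G)] under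
   [Fz \x gauss].  The equations hold in [\bar R], which forces every
   expectation in them to be finite. *)
Definition systemA (s : R * R * R * R) : Prop :=
  let: (alpha, beta, kappa, nu) := s in
  [/\ (alpha ^+ 2)%:E =
        ('E_(Ftheta \x gauss)[fun w => (reg_term beta nu w.1 w.2 ^+ 2)%R])%E,
      (beta ^+ 2)%:E =
        ((c * delta)%:E *
         'E_(Fz \x gauss)[fun w => (loss_term alpha kappa w.1 w.2 ^+ 2)%R])%E,
      (kappa * beta)%:E =
        ('E_(Ftheta \x gauss)[fun w =>
            (reg_term beta nu w.1 w.2 * - w.2)%R])%E &
      (nu * alpha)%:E =
        ((c * delta)%:E *
         'E_(Fz \x gauss)[fun w =>
            (loss_term alpha kappa w.1 w.2 * w.2)%R])%E].

Definition pos4 (s : R * R * R * R) : Prop :=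
  let: (alpha, beta, kappa, nu) := s in
  [/\ 0 < alpha, 0 < beta, 0 < kappa & 0 < nu].

(* Here [w = (Theta, (H, H~))] and [w = (Z, (G, G~))]; note that [etaH] is the
   correlation in the equation for [etaG], and vice versa. *)
Definition systemB (alpha beta kappa nu etaG etaH : R) : Prop :=
  [/\ -1 <= etaG <= 1, -1 <= etaH <= 1,
      etaG%:E =
        (((alpha ^+ 2)^-1)%:E *
         'E_(Ftheta \x gauss2 etaH)[fun w =>
            (reg_term beta nu w.1 w.2.1 * reg_term beta nu w.1 w.2.2)%R])%E &
      etaH%:E =
        ((c ^+ 2 * delta / beta ^+ 2)%:E *
         'E_(Fz \x gauss2 etaG)[fun w =>
            (loss_term alpha kappa w.1 w.2.1
             * loss_term alpha kappa w.1 w.2.2)%R])%E].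

End systems.

Definition limit_risk {R : realType} (alpha etaG : R) (M : nat) : R :=
  M%:R^-1 * alpha ^+ 2 + (1 - M%:R^-1) * etaG * alpha ^+ 2.

(* Main.v *)
Require Import Defs.
From HB Require Import structures.
From mathcomp Require Import all_boot all_order all_algebra.
From mathcomp Require Import all_classical all_reals all_analysis.
From mathcomp Require Import measurable_realfun ring lra.

Set Implicit Arguments.
Unset Strict Implicit.
Unset Printing Implicit Defensive.

Import Order.TTheory GRing.Theory Num.Theory.
Import numFieldNormedType.Exports.

Local Open Scope classical_set_scope.
Local Open Scope ring_scope.

(* The claim amounts to etaG < 1.  If etaG = 1, the second equations of systems
   A and B give etaH = c.  Write u for the regularization term.  As
   E[u(Theta, H)^2] = alpha^2 = E[u(Theta, H) u(Theta, H~)], where H and H~ have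
   correlation c, the case of equality in Cauchy-Schwarz yields
   u(Theta, H) = u(Theta, H~) almost surely.  Hence
   E[u(Theta, H) H] = E[u(Theta, H~) H~] = E[u(Theta, H) H~] = c E[u(Theta, H) H],
   and E[u(Theta, H) H] = 0 since c < 1; but by the third equation of system A
   it equals - kappa beta < 0.

   All these expectations require the measurability of the derivatives of the
   Moreau envelopes, obtained from their differentiability, and the exchange of
   H and H~ requires the symmetry of the bivariate Gaussian density. *)

(** * Differentiability of Moreau envelopes and measurability of their derivatives *)

Section moreau_envelope.
Context {R : realType}.

(** The slope [s] may depend on [e] but not on [h], so it cancels between two difference quotients.
    As [e] is arbitrary, quotients at [h] and [k] differ by at most [C * (|h| + |k|)]. They are
    therefore Cauchy at 0, and [R] is complete. *)
Lemma derivable_quadratic_error (g : R -> R) (C x : R) : 0 < C ->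
  (forall e, 0 < e ->
     exists s, forall h, `|g (x + h) - g x - h * s| <= C * h ^+ 2 + e) ->
  derivable g x 1.
Proof.
move=> C0 gC.
pose q h := h^-1 * (g (x + h) - g x).
have qq h k : h != 0 -> k != 0 -> `|q h - q k| <= C * (`|h| + `|k|).
  move=> h0 k0; apply/ler_addgt0Pr => e e0.
  (* Chosen so that the errors [d / |h|] and [d / |k|] left after division add up to [e]. *)
  pose d := e / (`|h|^-1 + `|k|^-1).
  have hk0 : 0 < `|h|^-1 + `|k|^-1 by rewrite addr_gt0 ?invr_gt0 ?normr_gt0.
  have [|s sP] := gC d; first exact: divr_gt0.
  have qs t : t != 0 -> `|q t - s| <= C * `|t| + d * `|t|^-1.
    move=> t0; have -> : q t - s = t^-1 * (g (x + t) - g x - t * s).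
      by rewrite /q; field.
    rewrite normrM normrV ?unitfE// mulrC ler_pdivrMr ?normr_gt0//.
    rewrite mulrDl -!mulrA mulVf ?normr_eq0// mulr1 -expr2 -normrX.
    by rewrite (ger0_norm (sqr_ge0 t)) sP.
  have -> : q h - q k = (q h - s) - (q k - s) by ring.
  rewrite (le_trans (ler_normB _ _))// (le_trans (lerD (qs _ h0) (qs _ k0)))//.
  have -> : e = d * (`|h|^-1 + `|k|^-1) by rewrite /d divfK// gt_eqF.
  by rewrite le_eqVlt; apply/orP; left; apply/eqP; ring.
rewrite /derivable; apply/cauchy_cvgP; apply/cauchy_exP => e e0.
(* For [|h| < k] the bound [C * (|h| + k)] is below [2 * C * k = e / 2], so the quotient at [k]
   serves as the center of the ball. *)
pose k := e / (4 * C).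
have k0 : 0 < k by rewrite divr_gt0// mulr_gt0.
exists (q k).
suff : \forall h \near 0^', ball (q k) e (q h).
  apply: filterS => h.
  by rewrite /q /= [h *: _]mulr1 [_ + x]addrC.
near=> h; rewrite -ball_normE /=.
have h0 : h != 0 by near: h; exact: nbhs_dnbhs_neq.
have hk : `|h| < k.
  by near: h; exact: dnbhs0_lt.
apply: le_lt_trans (qq _ _ _ h0) _; first by rewrite gt_eqF.
rewrite (gtr0_norm k0) (_ : e = C * (4 * k)).
  by rewrite ltr_pM2l//; lra.
by rewrite /k; field; rewrite gt_eqF.
Unshelve. all: by end_near. Qed.

(** The derivative is the pointwise limit of the difference quotients with step [1 / (n + 1)], which
    are measurable because [g] is continuous. *)
Lemma measurable_derive1 (g : R -> R) :
  (forall x, derivable g x 1) -> measurable_fun [set: R] (derive1 g).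
Proof.
move=> dg.
have mg : measurable_fun [set: R] g.
  apply: continuous_measurable_fun => x.
  by apply: differentiable_continuous; apply/derivable1_diffP.
apply: (@measurable_fun_cvg _ (measurableTypeR R) R setT (fun n x =>
   (n.+1%:R^-1)^-1 * (g (n.+1%:R^-1 + x) - g x)) (derive1 g)).
- move=> n; apply: measurable_funM => //; apply: measurable_funB => //.
  by apply: measurableT_comp => //; exact: measurable_funD.
- move=> x _; have := dg x; rewrite /derivable /derive1 => dgx.
  have /cvg_at_rightP/(_ harmonic) : h^-1 *: (g (h + x) - g x) @[h --> 0^'+] -->
      lim (h^-1 *: (g (h + x) - g x) @[h --> 0^']).
    apply: cvg_dnbhs_at_right.
    have -> : (fun h => h^-1 *: (g (h + x) - g x)) =
        (fun h => h^-1 *: (g (h *: 1 + x) - g x)).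
      by apply/funext => h; rewrite [h *: 1]mulr1.
    exact: dgx.
  by apply; split; [move=> n; rewrite /harmonic /= invr_gt0|exact: cvg_harmonic].
Qed.

Variables (f : R -> \bar R) (tau : R).
Hypotheses (f0 : f 0 \is a fin_num) (f_min : forall x, (f 0 <= f x)%E).
Hypothesis f_convex : convex_efun f.
Hypothesis tau0 : 0 < tau.

Let q (x y : R) : R := (2 * tau)^-1 * (x - y) ^+ 2.
Let S x := [set (f y + (q x y)%:E)%E | y in [set: R]].

Let q_ge0 x y : 0 <= q x y.
Proof. by rewrite mulr_ge0 ?sqr_ge0// invr_ge0 mulr_ge0// ltW. Qed.

Let f_gtNy x : (-oo < f x)%E.
Proof. by rewrite (lt_le_trans _ (f_min x))// -(fineK f0) ltNyr. Qed.

(** The infimum lies between [f 0] and the value at the competitor [y = 0]; hence [fine] in [env] is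
    faithful. *)
Let inf_fin x : ereal_inf (S x) \is a fin_num.
Proof.
rewrite fin_numE; apply/andP; split.
  rewrite gt_eqF// (@lt_le_trans _ _ (f 0))//.
  apply: le_ereal_inf_tmp => _ [y _ <-].
  by rewrite (le_trans (f_min y))// leeDl// lee_fin.
rewrite lt_eqF// (@le_lt_trans _ _ (f 0 + (q x 0)%:E)%E)//.
  by apply: ereal_inf_lbound; exists 0.
by rewrite -(fineK f0) -EFinD ltry.
Qed.

Lemma env_le x y r : f y = r%:E -> env f tau x <= r + q x y.
Proof.
move=> fy; rewrite -lee_fin /env fineK; last exact: inf_fin.
by apply: ereal_inf_lbound; exists y => //; rewrite fy -EFinD.
Qed.

Lemma env_adherent x e : 0 < e ->
  exists y r, f y = r%:E /\ r + q x y < env f tau x + e.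
Proof.
move=> e0; have [_ [y _ <-]] := lb_ereal_inf_adherent e0 (inf_fin x).
rewrite -[X in (_ < X + _)%E](fineK (inf_fin x)) -/(env f tau x) => h.
exists y; move: h (f_gtNy y).
case: (f y) => [r| |] //.
by rewrite -!EFinD lte_fin => h _; exists r.
Qed.

(** The midpoint [w] of near-minimizers at [x - h] and [x + h] competes at [x]: convexity controls
    [f w], and the parallelogram identity controls the quadratic term. *)
Lemma env_midconvex x h :
  2 * env f tau x <= env f tau (x - h) + env f tau (x + h).
Proof.
apply/ler_addgt0Pr => e e0.
have e20 : 0 < e / 2 by rewrite divr_gt0.
have [y [r [fy ry]]] := env_adherent (x - h) e20.
have [z [s [fz sz]]] := env_adherent (x + h) e20.
pose w := 2^-1 * y + (1 - 2^-1) * z.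
have := f_convex y z (t := 2^-1).
rewrite fy fz -/w => /(_ ltac:(apply/andP; split; lra)).
move: (f_gtNy w) (@env_le x w); case: (f w) => [t| |] //.
move=> _ /(_ _ erefl) le_t.
rewrite -!EFinM -EFinD lee_fin => tw.
have qw : 2 * q x w <= q (x - h) y + q (x + h) z.
  rewrite /q /w mulrCA -mulrDr ler_wpM2l//.
    by rewrite invr_ge0 mulr_ge0// ltW.
  rewrite -subr_ge0.
  have -> : (x - h - y) ^+ 2 + (x + h - z) ^+ 2 -
    2 * (x - (2^-1 * y + (1 - 2^-1) * z)) ^+ 2 =
    2^-1 * ((x - h - y) - (x + h - z)) ^+ 2 by field.
  by rewrite mulr_ge0 ?sqr_ge0.
lra.
Qed.

(* Near-minimizers [y] at [x] bound [env (x + k)] above by a parabola with slope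
   [(x - y) / tau] at [x]; midpoint convexity turns the bound at [- h] into a
   lower bound at [h].  No minimizer is needed, hence no lower semicontinuity. *)
Lemma env_derivable x : derivable (env f tau) x 1.
Proof.
have C0 : 0 < (2 * tau)^-1 by rewrite invr_gt0 mulr_gt0.
apply: (derivable_quadratic_error C0) => e e0.
have [y [r [fy ry]]] := env_adherent x e0.
exists (tau^-1 * (x - y)) => h.
have up k : env f tau (x + k) - env f tau x - k * (tau^-1 * (x - y)) <=
    (2 * tau)^-1 * k ^+ 2 + e.
  have := env_le (x + k) fy.
  have -> : q (x + k) y =
      q x y + k * (tau^-1 * (x - y)) + (2 * tau)^-1 * k ^+ 2.
    by rewrite /q; field; rewrite gt_eqF.
  lra.
rewrite ler_norml up andbT.
have := up (- h); rewrite sqrrN mulNr opprK; have := env_midconvex x h.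
lra.
Qed.

Lemma measurable_denv : measurable_fun [set: R] (denv f tau).
Proof. by apply: measurable_derive1 => x; exact: env_derivable. Qed.

End moreau_envelope.

(** * Density and symmetry of the bivariate Gaussian law *)

Section gaussian_pair.
Context {R : realType}.
Local Notation mu := (@lebesgue_measure R).
Local Notation RB := (measurableTypeR R).
Local Open Scope ereal_scope.

(** The pushforward of Lebesgue measure by [x |-> m + s * x], scaled by [s], gives intervals their
    length, so it is Lebesgue measure by uniqueness. *)
Lemma ge0_integral_affine (m s : R) (f : RB -> \bar R) : (0 < s)%R ->
  measurable_fun [set: RB] f -> (forall x, 0 <= f x) ->
  \int[mu]_x f x = s%:E * \int[mu]_x f (m + s * x)%R.
Proof.
move=> s0 mf f0.
have mphi : measurable_fun [set: RB] (fun x : RB => m + s * x : RB)%R.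
  by apply: measurable_funD => //; exact: measurable_funM.
pose phi (x : RB) : RB := (m + s * x)%R.
pose nu : {measure set RB -> \bar R} :=
  mscale (NngNum (ltW s0)) (pushforward mu phi).
rewrite (eq_measure_integral (nu mphi)).
  by rewrite ge0_integral_mscale//= ge0_integral_pushforward.
move=> A mA _; apply: lebesgue_measure_unique => // _ [[a b] _ <-].
rewrite /nu /= /mscale /= /pushforward.
rewrite [X in _ * mu X](_ : _ = [set` `](a - m) / s, (b - m) / s]]%R); last first.
  apply/seteqP; split => x; rewrite /= !in_itv /=;
    by rewrite ltr_pdivrMr// ler_pdivlMr// ltrBlDl lerBrDl mulrC.
rewrite !lebesgue_measure_itv/= !lte_fin.
rewrite ltr_pM2r ?invr_gt0// ltrBlDr subrK.
case: ifPn => ab; last by rewrite mule0.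
by rewrite -!EFinD -EFinM; congr (_%:E); field; rewrite gt_eqF.
Qed.

(** The Radon-Nikodym derivative and [normal_pdf] have the same integral over every measurable set,
    so they agree almost everywhere. *)
Lemma ge0_integral_normal_prob (m s : R) (f : RB -> \bar R) :
  measurable_fun [set: RB] f -> (forall x, 0 <= f x) ->
  \int[normal_prob m s]_x f x = \int[mu]_x (f x * (normal_pdf m s x)%:E).
Proof.
move=> mf f0.
have dom := normal_prob_dominates m s.
rewrite -(Radon_Nikodym_SigmaFinite.change_of_variables dom)//=.
have intRN := Radon_Nikodym_SigmaFinite.f_integrable dom.
apply: ae_eq_integral => //.
- by apply: emeasurable_funM => //; exact: measurable_int intRN.
- apply: emeasurable_funM => //; apply/measurable_EFinP.
  exact: measurable_normal_pdf.
- apply: ae_eqe_mul2l; apply: integral_ae_eq => //.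
  + by apply/measurable_EFinP; exact: measurable_normal_pdf.
  + by move=> A _ mA; rewrite -Radon_Nikodym_SigmaFinite.f_integral.
Qed.

(* Density of [gauss2 rho], as the standard normal density of [x] times the
   conditional density of [y] given [x]. *)
Definition gauss2_pdf (rho x y : R) : R :=
  let s := Num.sqrt (1 - rho ^+ 2) in
  (normal_pdf 0 1 x * (s^-1 * normal_pdf 0 1 ((y - rho * x) / s)))%R.

(** The two exponents add up to minus the symmetric form [(x^2 - 2 rho x y + y^2) / (2 (1 -
    rho^2))]. *)
Lemma gauss2_pdfC rho x y : (`|rho| < 1)%R ->
  gauss2_pdf rho x y = gauss2_pdf rho y x.
Proof.
move=> rho1.
have s0 : (0 < 1 - rho ^+ 2)%R by rewrite subr_gt0 -real_normK ?num_real// expr_lt1.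
rewrite /gauss2_pdf /normal_pdf oner_eq0.
set s := Num.sqrt _; set k := normal_peak 1.
have kE (a b : R) : (k * a * (s^-1 * (k * b)) = k ^+ 2 * s^-1 * (a * b))%R by ring.
rewrite !kE; congr (_ * _)%R; rewrite /normal_fun -!expRD; congr expR.
rewrite !subr0 !expr_div_n sqr_sqrtr ?ltW//; field.
by rewrite gt_eqF.
Qed.

Lemma gauss2_pdf_ge0 rho x y : (0 <= gauss2_pdf rho x y)%R.
Proof. by rewrite !mulr_ge0 ?normal_pdf_ge0// invr_ge0. Qed.

Lemma measurable_gauss2_pdf rho :
  measurable_fun [set: RB * RB] (fun w => gauss2_pdf rho w.1 w.2).
Proof.
apply: measurable_funM.
  exact: measurableT_comp (measurable_normal_pdf 0 1) measurable_fst.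
apply: measurable_funM => //.
apply: (measurableT_comp (measurable_normal_pdf 0 1)).
apply: measurable_funM => //; apply: measurable_funB => //.
exact: measurable_funM.
Qed.

Lemma ge0_integral_gauss2 rho (f : RB * RB -> \bar R) : (`|rho| < 1)%R ->
  measurable_fun [set: RB * RB] f -> (forall w, 0 <= f w) ->
  \int[gauss2 rho]_w f w =
  \int[mu]_x \int[mu]_y (f (x, y) * (gauss2_pdf rho x y)%:E).
Proof.
move=> rho1 mf f0; set s := Num.sqrt (1 - rho ^+ 2).
have s0 : (0 < s)%R.
  by rewrite sqrtr_gt0 subr_gt0 -real_normK ?num_real// expr_lt1.
have mfx x : measurable_fun [set: RB] (fun y => f (x, y)).
  exact: measurableT_comp.
have mpdf x : measurable_fun [set: RB]
    (fun y => (s^-1 * normal_pdf 0 1 ((y - rho * x) / s))%:E).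
  apply/measurable_EFinP; apply: measurable_funM => //.
  apply: (measurableT_comp (measurable_normal_pdf 0 1)).
  by apply: measurable_funM => //; apply: measurable_funB.
have pdf0 x y : (0 <= s^-1 * normal_pdf 0 1 ((y - rho * x) / s))%R.
  by rewrite mulr_ge0 ?normal_pdf_ge0// invr_ge0 ltW.
rewrite ge0_integral_distribution// fubini_tonelli1//=; last first.
  exact: measurableT_comp mf (measurable_corr_map rho).
(* For fixed [x], the second Gaussian [z] is replaced by [y = rho * x + s * z]; the Jacobian [s]
   cancels the factor [s^-1] of the conditional density. *)
transitivity (\int[normal_prob 0 1]_x
    \int[mu]_y (f (x, y) * (s^-1 * normal_pdf 0 1 ((y - rho * x) / s))%:E)).
  apply: eq_integral => x _; rewrite /fubini_F /= /corr_map /= -/s.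
  rewrite ge0_integral_normal_prob//; last first.
    by apply: (measurableT_comp (mfx x)); exact: measurable_funD.
  rewrite [RHS](ge0_integral_affine (rho * x) s0)//; first last.
  - by move=> y; rewrite mule_ge0// lee_fin.
  - exact: emeasurable_funM.
  rewrite -ge0_integralZl//; first last.
  - by rewrite lee_fin ltW.
  - by move=> y _; rewrite mule_ge0// lee_fin.
  - apply: (measurableT_comp (f := fun y => f (x, y) *
      (s^-1 * normal_pdf 0 1 ((y - rho * x) / s))%:E)).
      exact: emeasurable_funM.
    exact: measurable_funD.
  apply: eq_integral => y _; rewrite muleCA; congr (_ * _).
  rewrite -EFinM mulrA divff ?gt_eqF// mul1r; congr (normal_pdf _ _ _)%:E.
  by field; rewrite gt_eqF.
rewrite ge0_integral_normal_prob//.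
- apply: eq_integral => x _; rewrite muleC -ge0_integralZl//.
  + by apply: eq_integral => y _; rewrite muleCA -EFinM.
  + exact: emeasurable_funM.
  + by move=> y _; rewrite mule_ge0// lee_fin.
  + by rewrite lee_fin normal_pdf_ge0.
- apply: (measurable_fun_fubini_tonelli_F (fun w => f w *
    (s^-1 * normal_pdf 0 1 ((w.2 - rho * w.1) / s))%:E)).
    apply: emeasurable_funM => //; apply/measurable_EFinP.
    apply: measurable_funM => //.
    apply: (measurableT_comp (measurable_normal_pdf 0 1)).
    apply: measurable_funM => //; apply: measurable_funB => //.
    exact: measurable_funM.
  by move=> w; rewrite mule_ge0// lee_fin.
- by move=> x; apply: integral_ge0 => y _; rewrite mule_ge0// lee_fin.
Qed.

Lemma ge0_integral_gauss2_swap rho (f : RB * RB -> \bar R) :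
  (`|rho| < 1)%R ->
  measurable_fun [set: RB * RB] f -> (forall w, 0 <= f w) ->
  \int[gauss2 rho]_w f w = \int[gauss2 rho]_w f (w.2, w.1).
Proof.
move=> rho1 mf f0.
pose g w := f w * (gauss2_pdf rho w.1 w.2)%:E.
have mg : measurable_fun [set: RB * RB] g.
  apply: emeasurable_funM => //; apply/measurable_EFinP.
  exact: measurable_gauss2_pdf.
have g0 w : 0 <= g w by rewrite mule_ge0// lee_fin gauss2_pdf_ge0.
have mfC : measurable_fun [set: RB * RB] (fun w => f (w.2, w.1)).
  by apply: (measurableT_comp mf); exact: measurable_swap.
rewrite (ge0_integral_gauss2 rho1 mf f0).
rewrite (ge0_integral_gauss2 rho1 mfC (fun w => f0 (w.2, w.1))).
(* By symmetry of the density, the two sides now differ only in the order of integration. *)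
under [RHS]eq_integral do under eq_integral do rewrite gauss2_pdfC//.
exact: (@fubini_tonelli _ _ _ _ R mu mu g mg g0).
Qed.

End gaussian_pair.

(** * Transport of integrals along maps of Gaussian coordinates *)

Section decorrelation.
Context {R : realType}.
Local Notation RB := (measurableTypeR R).
Local Open Scope ereal_scope.

(** An integral is the difference of those of the positive and negative parts, and taking these
    parts commutes with composition by [h]. *)
Lemma eq_integral_of_ge0 d d' (T : measurableType d) (T' : measurableType d')
    (mu : {measure set T -> \bar R}) (nu : {measure set T' -> \bar R})
    (h : T' -> T) :
  (forall f, measurable_fun [set: T] f -> (forall x, 0 <= f x) ->
     \int[mu]_x f x = \int[nu]_x f (h x)) ->
  forall f, measurable_fun [set: T] f -> \int[mu]_x f x = \int[nu]_x f (h x).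
Proof.
move=> ge0 f mf; rewrite integralE [RHS]integralE.
rewrite (ge0 f^\+)//; last exact: measurable_funepos.
rewrite (ge0 f^\-)//; last exact: measurable_funeneg.
congr (_ - _); apply: eq_integral => x _.
  by rewrite -[LHS]/((f^\+ \o h) x) -funepos_comp.
by rewrite -[LHS]/((f^\- \o h) x) -funeneg_comp.
Qed.

(** Lifts a change of variables to a product with an independent variable: Tonelli reduces it to the
    fibers, first for nonnegative functions. *)
Lemma integral_prod_fiber d1 d2 d3 (T : measurableType d1)
    (U : measurableType d2) (V : measurableType d3)
    (m : {sigma_finite_measure set T -> \bar R})
    (m1 : {sigma_finite_measure set U -> \bar R})
    (m2 : {sigma_finite_measure set V -> \bar R}) (h : V -> U) :
  measurable_fun [set: V] h ->
  (forall g, measurable_fun [set: U] g -> (forall y, 0 <= g y) ->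
     \int[m1]_y g y = \int[m2]_z g (h z)) ->
  forall f, measurable_fun [set: T * U] f ->
  \int[m \x m1]_w f w = \int[m \x m2]_w f (w.1, h w.2).
Proof.
move=> mh ge0; apply: eq_integral_of_ge0 => f mf f0.
have mg : measurable_fun [set: T * V] (fun w => f (w.1, h w.2)).
  apply: (measurableT_comp mf); apply: measurable_fun_pair => //.
  exact: measurableT_comp.
rewrite (fubini_tonelli1 f mf f0) (fubini_tonelli1 _ mg (fun w => f0 _)).
by apply: eq_integral => x _; apply: ge0 => //; exact: measurableT_comp.
Qed.

(** If either part of [f] had an infinite integral, the value would be infinite. Each finite
    expectation in the systems thus yields integrability. *)
Lemma integrable_of_integral d (T : measurableType d)
    (mu : {measure set T -> \bar R}) (f : T -> \bar R) (r : R) :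
  measurable_fun [set: T] f -> \int[mu]_x f x = r%:E ->
  mu.-integrable [set: T] f.
Proof.
move=> mf fr; apply/integrableP; split=> //.
by apply/abse_integralP => //; rewrite fr ltry.
Qed.

(** The density is even and Lebesgue measure is invariant under reflection. *)
Lemma ge0_integral_gaussN (f : RB -> \bar R) :
  measurable_fun [set: RB] f -> (forall x, 0 <= f x) ->
  \int[gauss]_x f x = \int[gauss]_x f (- x)%R.
Proof.
move=> mf f0.
have mN : measurable_fun [set: RB] (fun x : RB => f (- x)%R).
  exact: measurableT_comp.
rewrite !ge0_integral_normal_prob//.
pose g x := f x * (normal_pdf 0 1 x)%:E.
have mg : measurable_fun [set: RB] g.
  apply: emeasurable_funM => //; apply/measurable_EFinP.
  exact: measurable_normal_pdf.
have gN x : f (- x)%R * (normal_pdf 0 1 x)%:E = g (- x)%R.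
  by rewrite /g /normal_pdf oner_eq0 /normal_fun !subr0 sqrrN.
under [RHS]eq_integral do rewrite gN.
rewrite -[RHS](@ge0_integral_pushforward _ _ _ _ R (-%R : RB -> RB) _ _ setT g)//.
- by apply: eq_measure_integral => //= A mA _; exact/esym/lebesgue_measureN.
- by move=> y _; rewrite mule_ge0// lee_fin normal_pdf_ge0.
Qed.

Lemma ge0_integral_gauss2_corr (rho : R) (g : RB * RB -> \bar R) :
  measurable_fun [set: RB * RB] g -> (forall y, 0 <= g y) ->
  \int[gauss2 rho]_y g y = \int[gauss \x gauss]_y g (corr_map rho y).
Proof.
pose gg : probability (RB * RB)%type R := gauss \x gauss.
move=> mg g0; exact: (@ge0_integral_distribution _ _ _ _ R gg (corr_map rho) g).
Qed.

Lemma ge0_integral_prod_fst d1 d2 (T : measurableType d1)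
    (U : measurableType d2) (m : {sigma_finite_measure set T -> \bar R})
    (p : probability U R) (f : T -> \bar R) :
  measurable_fun [set: T] f -> (forall x, 0 <= f x) ->
  \int[m \x p]_w f w.1 = \int[m]_x f x.
Proof.
move=> mf f0.
have mf1 : measurable_fun [set: T * U] (fun w => f w.1).
  exact: measurableT_comp.
rewrite (fubini_tonelli1 _ mf1 (fun w => f0 _)).
apply: eq_integral => x _; rewrite /fubini_F /=.
rewrite integral_cst// -[RHS]mule1; congr (_ * _).
exact: probability_setT.
Qed.

(** * Regression and equality in Cauchy-Schwarz for a correlated Gaussian pair *)

Variables (F : probability RB R) (rho : R).
Hypothesis rho1 : (`|rho| < 1)%R.
Let gauss12 : probability (RB * RB)%type R := gauss \x gauss.
(** [P] is the law of [(Theta, (H, H~))]; [Q] has in place of the pair the independent Gaussians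
    from which [corr_map] builds it. *)
Let P : probability (RB * (RB * RB))%type R := F \x gauss2 rho.
Let Q : probability (RB * (RB * RB))%type R := F \x gauss12.

Lemma integral_gauss2_corr f : measurable_fun [set: RB * (RB * RB)] f ->
  \int[P]_w f w = \int[Q]_w f (w.1, corr_map rho w.2).
Proof.
exact: (@integral_prod_fiber _ _ _ _ _ _ F (gauss2 rho) gauss12 _
  (measurable_corr_map rho) (@ge0_integral_gauss2_corr rho)).
Qed.

Lemma integral_gauss2_swap f : measurable_fun [set: RB * (RB * RB)] f ->
  \int[P]_w f w = \int[P]_w f (w.1, (w.2.2, w.2.1)).
Proof.
have mswap : measurable_fun [set: RB * RB] (fun y => (y.2, y.1) : RB * RB).
  exact: measurable_swap.
exact: (@integral_prod_fiber _ _ _ _ _ _ F (gauss2 rho) (gauss2 rho) _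
  mswap (fun g => @ge0_integral_gauss2_swap R rho g rho1)).
Qed.

Lemma integral_gauss2_fst f : measurable_fun [set: RB * RB] f ->
  \int[P]_w f (w.1, w.2.1) = \int[F \x gauss]_w f w.
Proof.
move=> mf; apply/esym; move: mf.
apply: (@integral_prod_fiber _ _ _ _ _ _ F gauss (gauss2 rho) _
  measurable_fst) => g mg g0.
have mg1 : measurable_fun [set: RB * RB] (fun y => g y.1).
  exact: measurableT_comp.
rewrite (ge0_integral_gauss2_corr rho mg1 (fun y => g0 _)).
exact/esym/ge0_integral_prod_fst.
Qed.

Lemma integral_gaussN_snd f : measurable_fun [set: RB * (RB * RB)] f ->
  \int[Q]_w f w = \int[Q]_w f (w.1, (w.2.1, - w.2.2)%R).
Proof.
have mN : measurable_fun [set: RB * RB] (fun y => (y.1, - y.2)%R : RB * RB).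
  by apply: measurable_fun_pair => //; exact: measurableT_comp.
apply: (@integral_prod_fiber _ _ _ _ _ _ F gauss12 gauss12 _ mN).
(* The reflection acts on the last of three factors, so the fiber argument is applied a second time,
   inside the Gaussian product. *)
move=> g mg _; move: g mg.
apply: (@integral_prod_fiber _ _ _ RB RB RB gauss gauss gauss (-%R : RB -> RB)).
  by [].
exact: ge0_integral_gaussN.
Qed.

Variable u : RB * RB -> R.
Hypothesis mfu : measurable_fun [set: RB * RB] u.

Let mu1 : measurable_fun [set: RB * (RB * RB)] (fun w => u (w.1, w.2.1)).
Proof.
apply: (measurableT_comp mfu); apply: measurable_fun_pair => //.
exact: measurableT_comp.
Qed.

Let mu2 : measurable_fun [set: RB * (RB * RB)] (fun w => u (w.1, w.2.2)).
Proof.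
apply: (measurableT_comp mfu); apply: measurable_fun_pair => //.
exact: measurableT_comp.
Qed.

Let mh1 : measurable_fun [set: RB * (RB * RB)] (fun w => w.2.1 : R).
Proof. exact: measurableT_comp. Qed.

Let mh2 : measurable_fun [set: RB * (RB * RB)] (fun w => w.2.2 : R).
Proof. exact: measurableT_comp. Qed.

(* [Q] is invariant under flipping the sign of the second Gaussian [z], and the
   average of [rho x + s z] and [rho x - s z] is [rho x]. *)
Lemma gauss2_regression (a b : R) :
  \int[P]_w (u (w.1, w.2.1) * w.2.2)%:E = a%:E ->
  \int[P]_w (u (w.1, w.2.1) * w.2.1)%:E = b%:E -> a = (rho * b)%R.
Proof.
have m12 : measurable_fun [set: RB * (RB * RB)]
    (fun w => (u (w.1, w.2.1) * w.2.2)%:E).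
  by apply/measurable_EFinP; exact: measurable_funM.
have m11 : measurable_fun [set: RB * (RB * RB)]
    (fun w => (u (w.1, w.2.1) * w.2.1)%:E).
  by apply/measurable_EFinP; exact: measurable_funM.
move=> Pa Pb; set s := Num.sqrt (1 - rho ^+ 2).
have mc : measurable_fun [set: RB * (RB * RB)]
    (fun w => (u (w.1, w.2.1) * (rho * w.2.1 + s * w.2.2))%:E).
  apply/measurable_EFinP; apply: measurable_funM => //.
  by apply: measurable_funD; exact: measurable_funM.
have mcN : measurable_fun [set: RB * (RB * RB)]
    (fun w => (u (w.1, w.2.1) * (rho * w.2.1 + s * - w.2.2))%:E).
  apply/measurable_EFinP; apply: measurable_funM => //.
  apply: measurable_funD; first exact: measurable_funM.
  by apply: measurable_funM => //; exact: measurableT_comp.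
have Qa : \int[Q]_w (u (w.1, w.2.1) * (rho * w.2.1 + s * w.2.2))%:E = a%:E.
  exact: (etrans (esym (integral_gauss2_corr m12)) Pa).
have QaN : \int[Q]_w (u (w.1, w.2.1) * (rho * w.2.1 + s * - w.2.2))%:E = a%:E.
  exact: (etrans (esym (integral_gaussN_snd mc)) Qa).
have Qb : \int[Q]_w (u (w.1, w.2.1) * w.2.1)%:E = b%:E.
  exact: (etrans (esym (integral_gauss2_corr m11)) Pb).
have ia := integrable_of_integral mc Qa.
have iaN := integrable_of_integral mcN QaN.
have ib := integrable_of_integral m11 Qb.
have := integralD measurableT ia iaN.
rewrite Qa QaN (eq_integral (fun w => (2 * rho)%:E *
  (u (w.1, w.2.1) * w.2.1)%:E)); last first.
  by move=> w _; rewrite -EFinD -EFinM; congr (_%:E); ring.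
rewrite (integralZl measurableT ib) Qb -EFinM -EFinD => -[]; lra.
Qed.

Lemma gauss2_decorrelation (a m : R) :
  \int[F \x gauss]_w (u w ^+ 2)%:E = a%:E ->
  \int[P]_w (u (w.1, w.2.1) * u (w.1, w.2.2))%:E = a%:E ->
  \int[F \x gauss]_w (u w * w.2)%:E = m%:E -> m = 0%R.
Proof.
move=> ua ub um.
have m11 : measurable_fun [set: RB * (RB * RB)]
    (fun w => (u (w.1, w.2.1) ^+ 2)%:E).
  by apply/measurable_EFinP; exact: measurable_funX.
have m22 : measurable_fun [set: RB * (RB * RB)]
    (fun w => (u (w.1, w.2.2) ^+ 2)%:E).
  by apply/measurable_EFinP; exact: measurable_funX.
have m12 : measurable_fun [set: RB * (RB * RB)]
    (fun w => (u (w.1, w.2.1) * u (w.1, w.2.2))%:E).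
  by apply/measurable_EFinP; exact: measurable_funM.
have mu1h1 : measurable_fun [set: RB * (RB * RB)]
    (fun w => (u (w.1, w.2.1) * w.2.1)%:E).
  by apply/measurable_EFinP; exact: measurable_funM.
have mu1h2 : measurable_fun [set: RB * (RB * RB)]
    (fun w => (u (w.1, w.2.1) * w.2.2)%:E).
  by apply/measurable_EFinP; exact: measurable_funM.
have mu2h2 : measurable_fun [set: RB * (RB * RB)]
    (fun w => (u (w.1, w.2.2) * w.2.2)%:E).
  by apply/measurable_EFinP; exact: measurable_funM.
have P11 : \int[P]_w (u (w.1, w.2.1) ^+ 2)%:E = a%:E.
  rewrite (@integral_gauss2_fst (fun w => (u w ^+ 2)%:E))//.
  by apply/measurable_EFinP; exact: measurable_funX.
(* Moments involving [H~] alone reduce to those of [H] by exchangeability of the pair. *)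
have P22 : \int[P]_w (u (w.1, w.2.2) ^+ 2)%:E = a%:E.
  by rewrite integral_gauss2_swap.
have Pu1h1 : \int[P]_w (u (w.1, w.2.1) * w.2.1)%:E = m%:E.
  rewrite (@integral_gauss2_fst (fun w => (u w * w.2)%:E))//.
  by apply/measurable_EFinP; exact: measurable_funM.
have Pu2h2 : \int[P]_w (u (w.1, w.2.2) * w.2.2)%:E = m%:E.
  by rewrite integral_gauss2_swap.
have i11 := integrable_of_integral m11 P11.
have i22 := integrable_of_integral m22 P22.
have i12 := integrable_of_integral m12 ub.
(* Expanding the square gives [a + (a - 2 a) = 0]; the three integrability facts justify
   linearity. *)
have sq0 : \int[P]_w `|((u (w.1, w.2.1) - u (w.1, w.2.2)) ^+ 2)%:E| = 0.
  transitivity (\int[P]_w ((u (w.1, w.2.1) ^+ 2)%:E +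
      ((u (w.1, w.2.2) ^+ 2)%:E +
       (-2)%:E * (u (w.1, w.2.1) * u (w.1, w.2.2))%:E))).
    apply: eq_integral => w _; rewrite gee0_abs ?lee_fin ?sqr_ge0//.
    by rewrite -EFinM -!EFinD; congr (_%:E); ring.
  have i12' : P.-integrable setT
      (fun w => (-2)%:E * (u (w.1, w.2.1) * u (w.1, w.2.2))%:E).
    exact: integrableZl.
  rewrite integralD//; last exact: integrableD.
  rewrite integralD// integralZl// P11 P22 ub -EFinM -!EFinD.
  by congr (_%:E); ring.
have u12 : ae_eq P setT (fun w => u (w.1, w.2.1)) (fun w => u (w.1, w.2.2)).
  have := (ae_eq_integral_abs P measurableT _).1 sq0.
  have msq : measurable_fun [set: RB * (RB * RB)]
      (fun w => ((u (w.1, w.2.1) - u (w.1, w.2.2)) ^+ 2)%:E).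
    by apply/measurable_EFinP; apply: measurable_funX; exact: measurable_funB.
  move=> /(_ msq); apply: filterS => w /= /(_ I) [] /eqP.
  by rewrite sqrf_eq0 subr_eq0 => /eqP.
have Pu1h2 : \int[P]_w (u (w.1, w.2.1) * w.2.2)%:E = m%:E.
  rewrite -Pu2h2; apply: ae_eq_integral => //.
  by apply: filterS u12 => w /= /[apply] ->.
(* Both integrals equal [m], so regression gives [m = rho * m] with [rho < 1]. *)
have := gauss2_regression Pu1h2 Pu1h1.
have : (rho < 1)%R by rewrite (le_lt_trans (ler_norm _)).
move=> rho_lt1 /eqP; rewrite -subr_eq0 -[X in (X - _)%R]mul1r -mulrBl mulf_eq0.
by rewrite subr_eq0 gt_eqF//= => /eqP.
Qed.

End decorrelation.

(** At [rho = 1] the second row of the Cholesky factor is [(1, 0)], so the pair sits on the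
    diagonal. This evaluates the equation for [etaH] when [etaG = 1]. *)
Lemma integral_gauss2_eq1 (R : realType) (F : probability (measurableTypeR R) R)
    (u : measurableTypeR R * measurableTypeR R -> R) :
  measurable_fun setT u ->
  (\int[F \x gauss2 1]_w (u (w.1, w.2.1) * u (w.1, w.2.2))%:E =
   \int[F \x gauss]_w (u w ^+ 2)%:E)%E.
Proof.
move=> mfu; set RB := measurableTypeR R in u mfu *.
have m11 : measurable_fun [set: RB * (RB * RB)] (fun w => u (w.1, w.2.1)).
  apply: (measurableT_comp mfu); apply: measurable_fun_pair => //.
  exact: measurableT_comp.
have m22 : measurable_fun [set: RB * (RB * RB)] (fun w => u (w.1, w.2.2)).
  apply: (measurableT_comp mfu); apply: measurable_fun_pair => //.
  exact: measurableT_comp.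
have msq1 : measurable_fun [set: RB * (RB * RB)]
    (fun w => (u (w.1, w.2.1) ^+ 2)%:E).
  by apply/measurable_EFinP; exact: measurable_funX.
have m12 : measurable_fun [set: RB * (RB * RB)]
    (fun w => (u (w.1, w.2.1) * u (w.1, w.2.2))%:E).
  by apply/measurable_EFinP; exact: measurable_funM.
have msq : measurable_fun [set: RB * RB] (fun w => (u w ^+ 2)%:E).
  by apply/measurable_EFinP; exact: measurable_funX.
apply: (etrans (integral_gauss2_corr F 1 m12)).
apply: (etrans _ (integral_gauss2_fst F 1 msq)).
apply: (etrans _ (esym (integral_gauss2_corr F 1 msq1))).
apply: eq_integral => w _ /=.
by rewrite expr1n subrr sqrtr0 mul0r addr0 mul1r expr2.
Qed.

(** * Measurability of the regularization and loss terms *)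

Section system_terms.
Context {R : realType}.
Local Notation RB := (measurableTypeR R).

Lemma measurable_reg_term (phi : R -> \bar R) (beta nu : R) :
  proper_closed_convex phi -> (forall x, (phi 0%R <= phi x)%E) -> 0 < nu ->
  measurable_fun [set: RB * RB] (fun w => reg_term phi beta nu w.1 w.2).
Proof.
move=> [[phi_gtNy [x0 phix0]] _ phi_convex] phi_min nu0.
(* The minimum of a proper function is finite. *)
have phi0 : phi 0 \is a fin_num.
  by rewrite fin_numE gt_eqF ?phi_gtNy//= lt_eqF// (le_lt_trans (phi_min x0)).
have nuV0 : 0 < nu^-1 by rewrite invr_gt0.
have mh : measurable_fun [set: RB * RB] (fun w => beta / nu * w.2).
  exact: measurable_funM.
apply: measurable_funB => //; apply: measurable_funM => //.
apply: (measurableT_comp (measurable_denv phi0 phi_min phi_convex nuV0)).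
exact: measurable_funD.
Qed.

Lemma measurable_loss_term (l : R -> R) (alpha kappa : R) :
  proper_closed_convex (EFin \o l) -> (forall x, l 0 <= l x) -> 0 < kappa ->
  measurable_fun [set: RB * RB] (fun w => loss_term l alpha kappa w.1 w.2).
Proof.
move=> [_ _ l_convex] l_min kappa0.
apply: (measurableT_comp (measurable_denv (f := EFin \o l) _ _ l_convex kappa0)).
- by [].
- by move=> x; rewrite /= lee_fin.
- by apply: measurable_funD => //; exact: measurable_funM.
Qed.

End system_terms.

(** * Strict decrease of the limiting risk, by excluding [etaG = 1] *)

Theorem proposition7 (R : realType)
    (Ftheta Fz : probability (measurableTypeR R) R) (delta c : R)
    (l : R -> R) (phi : R -> \bar R)
    (alpha beta kappa nu etaG etaH : R)
    (delta_gt0 : 0 < delta) (c01 : 0 < c < 1)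
    (l_pcc : proper_closed_convex (EFin \o l))
    (l_diff : forall x, derivable l x 1)
    (l_lip : exists k : R, k.-lipschitz (derive1 l))
    (l_min : forall x, l 0 <= l x)
    (phi_pcc : proper_closed_convex phi)
    (phi_min : forall x, (phi 0%R <= phi x)%E)
    (reg1_l : forall a : R,
      (\int[Fz \x gauss]_w
         (max_subgrad (EFin \o l) (a * w.2 + w.1)%R ^+ 2) < +oo)%E)
    (reg1_phi : forall a : R,
      (\int[Ftheta \x gauss]_w
         (max_subgrad phi (a * w.2 + w.1)%R ^+ 2) < +oo)%E)
    (reg2 : (0 < Ftheta [set theta : R | theta != 0%R])%E)
    (reg3 : unique
      (fun s => pos4 s /\ systemA l phi Ftheta Fz c delta s)
      (alpha, beta, kappa, nu))
    (reg4_incr : exists a b : R, a < b /\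
      {in `[a, b] &, forall x y, x < y -> derive1 l x < derive1 l y})
    (reg4_supp : msupport Fz = [set: R])
    (solB : systemB l phi Ftheta Fz c delta alpha beta kappa nu etaG etaH) :
  forall M : nat, (1 <= M)%N ->
    limit_risk alpha etaG M.+1 < limit_risk alpha etaG M.
Proof.
move=> M M1.
have [[alpha0 beta0 kappa0 nu0] [Aalpha Abeta Akappa _]] := reg3.1.
have [c0 c1] := andP c01.
have [/andP[_ etaG1] _ BG BH] := solB.
(* The drop in risk factors as [(1/M - 1/(M+1)) * (1 - etaG) * alpha^2]. *)
suff etaG_lt1 : etaG < 1.
  rewrite -subr_gt0 /limit_risk.
  have -> : M%:R^-1 * alpha ^+ 2 + (1 - M%:R^-1) * etaG * alpha ^+ 2 -
      (M.+1%:R^-1 * alpha ^+ 2 + (1 - M.+1%:R^-1) * etaG * alpha ^+ 2) =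
      (M%:R^-1 - M.+1%:R^-1) * ((1 - etaG) * alpha ^+ 2) by ring.
  rewrite !mulr_gt0 ?exprn_gt0 ?subr_gt0//.
  by rewrite ltf_pV2 ?posrE ?ltr0n// ltr_nat.
rewrite lt_neqAle etaG1 andbT; apply/eqP => etaG_eq1.
have mreg := measurable_reg_term beta phi_pcc phi_min nu0.
have mloss := measurable_loss_term alpha l_pcc l_min kappa0.
move: Aalpha Abeta Akappa BG BH; rewrite expectation.unlock => Aalpha Abeta Akappa.
rewrite etaG_eq1 => BG BH.
(* System A gives the second moment of the loss term as [beta^2 / (c * delta)]; multiplying by
   [c^2 * delta / beta^2] leaves [c]. *)
have etaH_c : etaH = c.
  have lossI := integral_gauss2_eq1 Fz mloss.
  have cd0 : c * delta != 0 by rewrite mulf_neq0 ?gt_eqF.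
  have /(congr1 (fun t => ((c * delta)^-1)%:E * t)%E) := Abeta.
  rewrite muleA -!EFinM mulVf// mul1e => lossE.
  move: BH; rewrite lossI -lossE -EFinM => -[->].
  by field; rewrite !gt_eqF.
have c_norm : `|c| < 1 by rewrite gtr0_norm.
have regE : (\int[Ftheta \x gauss]_w
    (reg_term phi beta nu w.1 w.2 * w.2)%:E = (- (kappa * beta))%:E)%E.
  have mreg2 : measurable_fun [set: (measurableTypeR R) * (measurableTypeR R)]
      (fun w => (reg_term phi beta nu w.1 w.2 * - w.2)%:E).
    apply/measurable_EFinP; apply: measurable_funM => //.
    exact: measurableT_comp.
  have ireg := integrable_of_integral mreg2 (esym Akappa).
  rewrite EFinN Akappa -mulN1e -integralZl//.
  by apply: eq_integral => w _; rewrite mulN1e -EFinN mulrN opprK.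
have BG' : (\int[Ftheta \x gauss2 c]_w
   (reg_term phi beta nu w.1 w.2.1 * reg_term phi beta nu w.1 w.2.2)%:E =
   (alpha ^+ 2)%:E)%E.
  have a20 : alpha ^+ 2 != 0 by rewrite gt_eqF// exprn_gt0.
  move: BG; rewrite etaH_c => /(congr1 (fun t => (alpha ^+ 2)%:E * t)%E).
  by rewrite mule1 muleA -EFinM divff// mul1e => ->.
(* Decorrelation at [rho = c] forces [kappa * beta = 0], against positivity. *)
have := gauss2_decorrelation c_norm mreg (esym Aalpha) BG' regE.
by move=> /eqP; rewrite oppr_eq0 gt_eqF// mulr_gt0.
Qed.
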